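(* Let $b,\bar m,r\ge1$ be integers. Consider a variational distribution that is a finite mixture of factorized categorical distributions, $$\mathbf{q}=\sum_{j=1}^r\alpha_j\bigotimes_{i=1}^b\mathbf{q}_i^{(j)}\in\mathbb{R}^{\bar m^b},$$ where $\boldsymbol{\alpha}\in(0,1)^r$ is a vector of mixture probabilities ($\sum_{j}\alpha_j=1$) and each $\mathbf{q}_i^{(j)}\in(0,1)^{\bar m}$ is a probability vector (entries summing to $1$). Then the following inequality holds: $$-\mathbf{q}^T\log\mathbf{q}\;\ge\;\max_{\{\mathbf{a}_i\in(0,1)^{\bar m}\}_{i=1}^b}\;1-\sum_{j=1}^r\alpha_j\Bigg(\sum_{i=1}^b\mathbf{q}_i^{(j)\,T}\log\mathbf{a}_i+\alpha_j\prod_{i=1}^b\mathbf{q}_i^{(j)\,T}\frac{\mathbf{q}_i^{(j)}}{\mathbf{a}_i}+2\sum_{k=j+1}^r\alpha_k\prod_{i=1}^b\mathbf{q}_i^{(j)\,T}\frac{\mathbf{q}_i^{(k)}}{\mathbf{a}_i}\Bigg),$$ where $\mathbf{a}=\bigotimes_{i=1}^b\mathbf{a}_i$, with $\mathbf{a}_i\in(0,1)^{\bar m}$, is the center of the (first-order) Taylor series approximation of $\log\mathbf{q}$.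
   Context: There are $b$ discrete latent variables $w_1,\dots,w_b$, each taking one of $\bar m$ values. The vector $\mathbf{q}$ lists the probabilities that the variational distribution assigns to all $\bar m^b$ joint configurations, and $\mathbf{q}_i^{(j)}$ lists the probabilities of the $\bar m$ values of $w_i$ given mixture component $j$. Here $\otimes$ is the Kronecker product, and logarithms and quotients of vectors are elementwise. The $\mathbf{a}_i$ are arbitrary vectors with entries in $(0,1)$ (not required to sum to $1$). The first-order Taylor approximation of $\log\mathbf{q}$ about $\mathbf{a}$ is, elementwise, $\log\mathbf{a}+(\mathbf{q}-\mathbf{a})/\mathbf{a}$. The left-hand side is the entropy term of the evidence lower bound.
   Formalization: The maximum over the open cubes (0,1)^m̄ need not be attained (e.g. for some mixtures with b = m̄ = r = 2), so ''max'' is replaced by the supremum, which equals the maximum whenever the latter exists. *)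

(* Defs.v *)
From HB Require Import structures.
From mathcomp Require Import all_boot all_order all_algebra.
From mathcomp.real_closed Require Import mxtens.
From mathcomp Require Import all_classical all_reals all_analysis.

Set Implicit Arguments.
Unset Strict Implicit.
Unset Printing Implicit Defensive.

Import Order.TTheory GRing.Theory Num.Theory.

Local Open Scope classical_set_scope.
Local Open Scope ring_scope.

Section Definitions.
Variable R : realType.

Definition dotv n (u v : 'cV[R]_n) : R := (u^T *m v) 0 0.

Definition logv n (u : 'cV[R]_n) : 'cV[R]_n := map_mx (@ln R) u.

Definition divv n (u v : 'cV[R]_n) : 'cV[R]_n := map2_mx (fun x y => x / y) u v.

Definition unit_cube n : set 'cV[R]_n := [set v | forall i, 0 < v i 0 < 1].

Definition prob_vector n (v : 'cV[R]_n) : Prop :=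
  unit_cube v /\ \sum_i v i 0 = 1.

(* v_0 *t (v_1 *t (... *t v_(b-1))); [tensmx] is the Kronecker product, and the
   casts identify m * m ^ b with m ^ b.+1 and the number of columns 1 * 1 with
   1. The empty product is the 1-dimensional vector 1. *)
Fixpoint bigkron (m b : nat) : ('I_b -> 'cV[R]_m) -> 'cV[R]_(m ^ b) :=
  match b return ('I_b -> 'cV[R]_m) -> 'cV[R]_(m ^ b) with
  | 0 => fun _ => const_mx 1
  | b'.+1 => fun v =>
      castmx (esym (expnS m b'), muln1 1)
        (v ord0 *t bigkron (fun i => v (lift ord0 i)))
  end.

Definition mixture (b m r : nat) (alpha : 'cV[R]_r)
    (q : 'I_r -> 'I_b -> 'cV[R]_m) : 'cV[R]_(m ^ b) :=
  \sum_(j < r) alpha j 0 *: bigkron (q j).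

Definition entropy n (p : 'cV[R]_n) : R := - dotv p (logv p).

Definition taylor1_log n (c p : 'cV[R]_n) : 'cV[R]_n :=
  logv c + divv (p - c) c.

Definition mixture_bound (b m r : nat) (alpha : 'cV[R]_r)
    (q : 'I_r -> 'I_b -> 'cV[R]_m) (a : 'I_b -> 'cV[R]_m) : R :=
  1 - \sum_(j < r) alpha j 0 *
        (\sum_(i < b) dotv (q j i) (logv (a i))
         + alpha j 0 * \prod_(i < b) dotv (q j i) (divv (q j i) (a i))
         + 2 * \sum_(k < r | (j < k)%N)
                 alpha k 0 * \prod_(i < b) dotv (q j i) (divv (q k i) (a i))).

End Definitions.

(* Main.v *)
(* Concavity gives [ln x <= ln c + (x - c) / c] for positive [c] and [x], so
   replacing [log q] by its Taylor approximation about any positive [a] can only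
   lower the entropy.  With [a] a Kronecker product the lowered value factorizes:
   [q] sums to 1, [log a] splits into a sum over the factors, and [q^T (q / a)]
   is a double sum over the components, symmetric in [j] and [k]. *)

Require Import Defs.
From HB Require Import structures.
From mathcomp Require Import all_boot all_order all_algebra.
From mathcomp.real_closed Require Import mxtens.
From mathcomp Require Import ring.
From mathcomp Require Import all_classical all_reals all_analysis.

Set Implicit Arguments.
Unset Strict Implicit.
Unset Printing Implicit Defensive.

Import Order.TTheory GRing.Theory Num.Theory.

Local Open Scope classical_set_scope.
Local Open Scope ring_scope.

Section DotProduct.
Variables (R : realType) (n : nat).
Implicit Types (u v c p : 'cV[R]_n).

Lemma dotvE u v : dotv u v = \sum_x u x 0 * v x 0.
Proof. by rewrite /dotv mxE; apply: eq_bigr => x _; rewrite mxE. Qed.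

Lemma dotvDr u v w : dotv u (v + w) = dotv u v + dotv u w.
Proof. by rewrite /dotv mulmxDr mxE. Qed.

Lemma dotv_suml r (alpha : 'cV[R]_r) (K : 'I_r -> 'cV[R]_n) v :
  dotv (\sum_j alpha j 0 *: K j) v = \sum_j alpha j 0 * dotv (K j) v.
Proof.
rewrite /dotv linear_sum /= mulmx_suml summxE; apply: eq_bigr => j _.
by rewrite linearZ /= -scalemxAl mxE.
Qed.

Lemma dotv_sumr r (alpha : 'cV[R]_r) (K : 'I_r -> 'cV[R]_n) u :
  dotv u (\sum_j alpha j 0 *: K j) = \sum_j alpha j 0 * dotv u (K j).
Proof.
rewrite /dotv mulmx_sumr summxE; apply: eq_bigr => j _.
by rewrite -scalemxAr mxE.
Qed.

Lemma dotv_divC u v c : dotv u (divv v c) = dotv v (divv u c).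
Proof. by rewrite !dotvE; apply: eq_bigr => x _; rewrite !mxE mulrCA. Qed.

(** Since [c / c] is the all-ones vector, centering costs only the total mass of [u]. For a
    probability vector this mass is the leading 1 of the bound. *)
Lemma dotv_div_center u p c : (forall x, 0 < c x 0) ->
  dotv u (divv (p - c) c) = dotv u (divv p c) - \sum_x u x 0.
Proof.
move=> c_gt0; rewrite !dotvE -sumrB; apply: eq_bigr => x _.
by rewrite !mxE mulrBl divff ?gt_eqF// mulrBr mulr1.
Qed.

Lemma divv_suml r (alpha : 'cV[R]_r) (K : 'I_r -> 'cV[R]_n) c :
  divv (\sum_j alpha j 0 *: K j) c = \sum_j alpha j 0 *: divv (K j) c.
Proof.
apply/matrixP => x y; rewrite !mxE !summxE mulr_suml; apply: eq_bigr => j _.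
by rewrite !mxE mulrA.
Qed.

Lemma logv_le_taylor1 c p x :
  0 < c x 0 -> 0 < p x 0 -> logv p x 0 <= taylor1_log c p x 0.
Proof.
move=> c_gt0 p_gt0; rewrite !mxE.
rewrite -lerBlDl -ln_div ?posrE// mulrBl divff ?gt_eqF//.
(* What remains is [ln (1 + t) <= t] at [t = p x 0 / c x 0 - 1], with [t > -1] because the quotient
   is positive. *)
rewrite -{1}(subrK 1 (p x 0 / c x 0)) addrC le_ln1Dx//.
by rewrite ltrBrDl subrr divr_gt0.
Qed.

Lemma entropy_ge_taylor1 c p : (forall x, 0 < c x 0) -> (forall x, 0 < p x 0) ->
  - dotv p (taylor1_log c p) <= entropy p.
Proof.
move=> c_gt0 p_gt0; rewrite lerN2 !dotvE; apply: ler_sum => x _.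
by rewrite ler_wpM2l ?logv_le_taylor1 ?ltW.
Qed.

End DotProduct.

Section KroneckerPower.
Variables (R : realType) (m : nat).

(** A joint configuration is the value [i] of the first variable followed by a configuration [x] of
    the others. The cast is the one in [bigkron], so the two cancel in [bigkronS], and the
    inductions on [b] below never meet a cast again. *)
Definition kron_index b (i : 'I_m) (x : 'I_(m ^ b)) : 'I_(m ^ b.+1) :=
  cast_ord (esym (expnS m b)) (mxtens_index (i, x)).

Lemma kron_indexP b (y : 'I_(m ^ b.+1)) : exists i x, y = kron_index i x.
Proof.
exists (mxtens_unindex (cast_ord (expnS m b) y)).1.
exists (mxtens_unindex (cast_ord (expnS m b) y)).2.
by rewrite /kron_index -surjective_pairing mxtens_unindexK cast_ordK.
Qed.

Lemma sum_kron_index b (F : 'I_(m ^ b.+1) -> R) :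
  \sum_y F y = \sum_i \sum_x F (@kron_index b i x).
Proof.
rewrite pair_big /= (reindex (fun p => @kron_index b p.1 p.2)) //=.
exists (fun y => mxtens_unindex (cast_ord (expnS m b) y)).
  by move=> [i x] _; rewrite /kron_index cast_ordKV mxtens_indexK.
by move=> y _; rewrite /kron_index -surjective_pairing mxtens_unindexK cast_ordK.
Qed.

Lemma bigkronS b (v : 'I_b.+1 -> 'cV[R]_m) i x :
  bigkron v (kron_index i x) 0 =
  v ord0 i 0 * bigkron (fun k => v (lift ord0 k)) x 0.
Proof.
rewrite /= castmxE /= /kron_index esymK cast_ordKV.
(* The only column index of a [1 * 1]-column product is the pair of zeros. *)
rewrite (_ : cast_ord _ 0 = mxtens_index (0, 0)) ?tensmxE //.
exact: val_inj.
Qed.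

Lemma bigkron_gt0 b (v : 'I_b -> 'cV[R]_m) :
  (forall k i, 0 < v k i 0) -> forall x, 0 < bigkron v x 0.
Proof.
elim: b v => [|b IH] v v_gt0 y; first by rewrite mxE.
have [i [x ->]] := kron_indexP y.
by rewrite bigkronS mulr_gt0// IH.
Qed.

Lemma divv_bigkron b (u v : 'I_b -> 'cV[R]_m) :
  divv (bigkron u) (bigkron v) = bigkron (fun k => divv (u k) (v k)).
Proof.
apply/matrixP => y z; rewrite ord1.
elim: b u v y => [|b IH] u v y; first by rewrite !mxE divr1.
have [i [x ->]] := kron_indexP y.
by rewrite mxE !bigkronS -IH !mxE invfM mulrACA.
Qed.

(** By distributivity, a sum over [m ^ b] configurations of products of one-variable terms collapses
    to [b] sums of [m] terms. *)
Lemma dotv_bigkron b (u v : 'I_b -> 'cV[R]_m) :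
  dotv (bigkron u) (bigkron v) = \prod_k dotv (u k) (v k).
Proof.
elim: b u v => [|b IH] u v.
  by rewrite big_ord0 dotvE big_ord1 !mxE mulr1.
rewrite big_ord_recl -IH !dotvE sum_kron_index mulr_suml.
apply: eq_bigr => i _; rewrite mulr_sumr; apply: eq_bigr => x _.
by rewrite !bigkronS mulrACA.
Qed.

Lemma sum_bigkron b (u : 'I_b -> 'cV[R]_m) :
  \sum_x bigkron u x 0 = \prod_k \sum_i u k i 0.
Proof.
elim: b u => [|b IH] u; first by rewrite big_ord0 big_ord1 mxE.
rewrite big_ord_recl -IH sum_kron_index mulr_suml.
apply: eq_bigr => i _; rewrite mulr_sumr; apply: eq_bigr => x _.
by rewrite bigkronS.
Qed.

(** The logarithm turns the product of entries into a sum whose [k]-th term depends on the [k]-th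
    variable alone; the other factors of [u] then sum out to 1. *)
Lemma dotv_log_bigkron b (u a : 'I_b -> 'cV[R]_m) :
  (forall k, \sum_i u k i 0 = 1) -> (forall k i, 0 < a k i 0) ->
  dotv (bigkron u) (logv (bigkron a)) = \sum_k dotv (u k) (logv (a k)).
Proof.
elim: b u a => [|b IH] u a u1 a_gt0.
  by rewrite big_ord0 dotvE big_ord1 !mxE ln1 mulr0.
have ut1 : \sum_x bigkron (fun k => u (lift ord0 k)) x 0 = 1.
  by rewrite sum_bigkron big1.
rewrite big_ord_recl -IH // !dotvE sum_kron_index.
(* Multiply the head term by the mass of the tail and the tail term by the mass of the head, both 1,
   so that both become double sums comparable term by term. *)
rewrite -[X in _ = X + _]mulr1 -ut1 -[X in _ = _ + X]mul1r -(u1 ord0).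
rewrite !mulr_suml -big_split; apply: eq_bigr => i _.
rewrite !mulr_sumr -big_split; apply: eq_bigr => x _ /=.
rewrite 2!mxE !bigkronS lnM ?posrE ?bigkron_gt0 // !mxE.
by ring.
Qed.

End KroneckerPower.

Lemma sum_symmetric (R : realType) r (F : 'I_r -> 'I_r -> R) :
  (forall j k, F j k = F k j) ->
  \sum_j \sum_k F j k =
  \sum_(j < r) (F j j + 2 * \sum_(k < r | (j < k)%N) F j k).
Proof.
move=> Fsym.
have -> : \sum_j \sum_k F j k =
    \sum_(j < r) (F j j + \sum_(k < r | (j < k)%N) F j k)
    + \sum_(j < r) \sum_(k < r | (k < j)%N) F j k.
  rewrite -big_split; apply: eq_bigr => j _ /=.
  (* Each row splits into its diagonal entry, the part above the diagonal and the part below;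
     exchanging the sums later folds the last onto the second. *)
  rewrite (bigD1 j) //= (bigID (fun k : 'I_r => (j < k)%N)) /= addrA.
  by congr (_ + _ + _); apply: eq_bigl => k; rewrite -val_eqE /=; case: ltngtP.
have -> : \sum_(j < r) \sum_(k < r | (k < j)%N) F j k =
    \sum_(j < r) \sum_(k < r | (j < k)%N) F j k.
  rewrite (exchange_big_dep xpredT) //=; apply: eq_bigr => j _.
  exact: eq_bigr.
by rewrite -big_split; apply: eq_bigr => j _ /=; ring.
Qed.

Section Mixture.
Variables (R : realType) (b m r : nat).
Variables (alpha : 'cV[R]_r) (q : 'I_r -> 'I_b -> 'cV[R]_m).
Hypotheses (halpha : prob_vector alpha) (hq : forall j i, prob_vector (q j i)).

Lemma mixture_gt0 x : (0 < r)%N -> 0 < mixture alpha q x 0.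
Proof.
have [alpha01 _] := halpha.
have term_gt0 j : 0 < (alpha j 0 *: bigkron (q j)) x 0.
  rewrite mxE mulr_gt0 ?(andP (alpha01 j)).1 // bigkron_gt0 // => k i.
  by have [/(_ i)/andP[]] := hq j k.
move=> r_gt0; rewrite summxE (bigD1 (Ordinal r_gt0)) //=.
by rewrite ltr_wpDr // sumr_ge0 // => j _; rewrite ltW.
Qed.

Lemma sum_mixture : \sum_x mixture alpha q x 0 = 1.
Proof.
have [_ <-] := halpha.
under eq_bigr do rewrite summxE.
rewrite exchange_big; apply: eq_bigr => j _ /=.
under eq_bigr do rewrite mxE.
rewrite -mulr_sumr sum_bigkron big1 ?mulr1 // => k _.
by have [] := hq j k.
Qed.

Lemma mixture_boundE (a : 'I_b -> 'cV[R]_m) : (forall k i, 0 < a k i 0) ->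
  mixture_bound alpha q a =
  - dotv (mixture alpha q) (taylor1_log (bigkron a) (mixture alpha q)).
Proof.
move=> a_gt0; rewrite dotvDr dotv_div_center; last exact: bigkron_gt0.
rewrite sum_mixture addrA opprB; congr (1 - _).
pose P j k := \prod_i dotv (q j i) (divv (q k i) (a i)).
(* Each factor of [P j k] sums entrywise products of [q j i] and [q k i] over [a i], so [j] and [k]
   can be swapped. *)
have Psym j k : alpha j 0 * (alpha k 0 * P j k) = alpha k 0 * (alpha j 0 * P k j).
  by rewrite mulrCA; do 2 congr (_ * _); apply: eq_bigr => i _; rewrite dotv_divC.
have -> : dotv (mixture alpha q) (divv (mixture alpha q) (bigkron a)) =
    \sum_j \sum_k alpha j 0 * (alpha k 0 * P j k).
  rewrite divv_suml dotv_suml; apply: eq_bigr => j _.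
  rewrite dotv_sumr mulr_sumr; apply: eq_bigr => k _.
  by rewrite divv_bigkron dotv_bigkron.
rewrite sum_symmetric // dotv_suml -big_split; apply: eq_bigr => j _ /=.
rewrite dotv_log_bigkron //; last by move=> k; have [] := hq j k.
by rewrite -mulr_sumr !mulrDr [alpha j 0 * (2 * _)]mulrCA addrA.
Qed.

End Mixture.

(** The maximum is encoded as a supremum in the extended reals, which does not presuppose that it is
    attained. The second conjunct records in what sense the Kronecker product of the [a i] is the
    center of the Taylor approximation. *)
Theorem theorem3 (R : realType) (b m r : nat)
    (hb : (0 < b)%N) (hm : (0 < m)%N) (hr : (0 < r)%N)
    (alpha : 'cV[R]_r) (q : 'I_r -> 'I_b -> 'cV[R]_m)
    (halpha : prob_vector alpha)
    (hq : forall j i, prob_vector (q j i)) :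
  (ereal_sup [set (mixture_bound alpha q a)%:E
               | a in [set a : 'I_b -> 'cV[R]_m | forall i, unit_cube (a i)]]
     <= (entropy (mixture alpha q))%:E)%E
  /\ (forall a : 'I_b -> 'cV[R]_m, (forall i, unit_cube (a i)) ->
       mixture_bound alpha q a =
       - dotv (mixture alpha q) (taylor1_log (bigkron a) (mixture alpha q))).
Proof.
have cube_gt0 (a : 'I_b -> 'cV[R]_m) :
    (forall i, unit_cube (a i)) -> forall k i, 0 < a k i 0.
  by move=> ha k i; have /andP[] := ha k i.
split=> [|a ha]; last exact/(mixture_boundE halpha hq)/cube_gt0.
apply: ge_ereal_sup => _ [a ha <-]; rewrite lee_fin.
rewrite (mixture_boundE halpha hq (cube_gt0 a ha)).
apply: entropy_ge_taylor1 => x; last exact: mixture_gt0.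
exact/bigkron_gt0/cube_gt0.
Qed.
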